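(* There is an oracle $A\in 2^\omega$ and some $X\in 2^\omega$ with $X\leq_{\omega_1^{ck}T}A$ such that for no everywhere consistent higher Turing functional $\Phi$ do we have $\Phi(A)=X$.
   Context: A higher Turing functional is a $\Pi^1_1$ (lightface) set $\Phi\subseteq 2^{<\omega}\times 2^{<\omega}$. It is consistent on $B\in 2^\omega$ if any two strings $\sigma,\sigma'$ for which there are finite initial segments $\tau,\tau'$ of $B$ with $(\tau,\sigma),(\tau',\sigma')\in\Phi$ are comparable. It is everywhere consistent if it is consistent on every $B\in 2^\omega$. For $B,Y\in 2^\omega$, $\Phi(B)=Y$ means that $\Phi$ is consistent on $B$ and the union of all $\sigma$ such that $(\tau,\sigma)\in\Phi$ for some finite initial segment $\tau$ of $B$ is $Y$. $Y\leq_{\omega_1^{ck}T}B$ ($Y$ is higher $B$-computable) means that $\Phi(B)=Y$ for some higher Turing functional $\Phi$ (not necessarily everywhere consistent). *)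

(* Defs.v *)
From mathcomp Require Import all_boot.

Set Implicit Arguments.
Unset Strict Implicit.
Unset Printing Implicit Defensive.

(* Arithmetical formulas with number variables and (unary) function variables,
   both named by natural numbers. *)

Inductive term : Type :=
  | TVar (x : nat)
  | TZero
  | TSucc (t : term)
  | TAdd (t u : term)
  | TMul (t u : term)
  | TApp (f : nat) (t : term).

Inductive formula : Type :=
  | FEq (t u : term)
  | FLt (t u : term)
  | FNot (p : formula)
  | FAnd (p q : formula)
  | FOr (p q : formula)
  | FAll (x : nat) (p : formula)
  | FEx (x : nat) (p : formula).

Fixpoint teval (F : nat -> nat -> nat) (e : nat -> nat) (t : term) : nat :=
  match t with
  | TVar x => e x
  | TZero => 0
  | TSucc t => (teval F e t).+1
  | TAdd t u => teval F e t + teval F e u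
  | TMul t u => teval F e t * teval F e u
  | TApp f t => F f (teval F e t)
  end.

Fixpoint holds (F : nat -> nat -> nat) (e : nat -> nat) (p : formula) : Prop :=
  match p with
  | FEq t u => teval F e t = teval F e u
  | FLt t u => teval F e t < teval F e u
  | FNot p => ~ holds F e p
  | FAnd p q => holds F e p /\ holds F e q
  | FOr p q => holds F e p \/ holds F e q
  | FAll x p => forall n : nat, holds F [eta e with x |-> n] p
  | FEx x p => exists n : nat, holds F [eta e with x |-> n] p
  end.

(* The number whose binary expansion is 1 followed by s, most significant bit
   first. *)
Definition string_code (s : seq bool) : nat :=
  foldl (fun (n : nat) (b : bool) => n.*2 + b) 1 s.

(* Lightface: the formula has no parameters. As a formula mentions only finitely
   many function variables, the quantifier over F amounts to a finite block of
   universal function quantifiers in front of an arithmetical matrix. Number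
   variables other than 0 and 1 denote 0 where they occur free. *)
Definition Pi11 (Phi : seq bool * seq bool -> Prop) : Prop :=
  exists p : formula, forall t s : seq bool,
    Phi (t, s) <->
    (forall F : nat -> nat -> nat,
       holds F (nth 0 [:: string_code t; string_code s]) p).

Definition higher_Turing_functional (Phi : seq bool * seq bool -> Prop) : Prop :=
  Pi11 Phi.

Definition initial_segment (t : seq bool) (B : nat -> bool) : Prop :=
  exists n : nat, t = mkseq B n.

Definition comparable (s s' : seq bool) : bool := prefix s s' || prefix s' s.

Definition consistent_on (Phi : seq bool * seq bool -> Prop) (B : nat -> bool)
    : Prop :=
  forall s s' : seq bool,
    (exists t, initial_segment t B /\ Phi (t, s)) ->
    (exists t', initial_segment t' B /\ Phi (t', s')) ->
    comparable s s'.

Definition everywhere_consistent (Phi : seq bool * seq bool -> Prop) : Prop :=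
  forall B : nat -> bool, consistent_on Phi B.

(* The second conjunct is the equality of graphs between Y and the union of the
   strings s, a string being viewed as a finite partial function. *)
Definition functional_maps (Phi : seq bool * seq bool -> Prop)
    (B Y : nat -> bool) : Prop :=
  consistent_on Phi B /\
  forall (n : nat) (b : bool),
    (exists t s, [/\ initial_segment t B, Phi (t, s) & onth s n = Some b]) <->
    Y n = b.

Definition higher_computable (Y B : nat -> bool) : Prop :=
  exists Phi, higher_Turing_functional Phi /\ functional_maps Phi B Y.

(* Main.v *)
Require Import Defs.
From Stdlib Require Import Wf_nat PeanoNat Compare_dec.
From mathcomp Require Import all_boot zify boolp.

Set Implicit Arguments.
Unset Strict Implicit.
Unset Printing Implicit Defensive.

(* Let W_n be the open set of oracles on which the n-th functional outputs a string with
   n-th bit 0. We build A such that A decides, for each n, whether A lies in the closure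
   of W_n, and set X(n) = 1 iff it does. If X(n) = 0, the n-th functional cannot output
   X(n) = 0 on A. If X(n) = 1 and the n-th functional outputs 1 at n on a prefix of A,
   then some oracle extending that prefix lies in W_n, so the functional is inconsistent
   there.
   A is the limit of strings T_n. Positions are arranged in columns, and beyond T_n only
   columns >= n may contain ones. If every extension of T_n by ones in columns > n meets
   W_n, then T_(n+1) = T_n and column n is closed; otherwise some such extension avoids
   W_n, and T_(n+1) is that extension followed by a one in column n. A one of column n
   counts as a mark only if all later ones lie in columns > n, so the ones that an earlier
   stage may have put into column n are cancelled by the closing one of that stage. Hence
   X(n) = 0 is visible on A as a mark, whereas X(n) = 1 is a Pi^1_1 event, enumerated only
   once all smaller columns are settled. False outputs occur only on other oracles, which
   is why the functional is not everywhere consistent. *)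

(** * A universal evaluator of formula codes *)

(* An injective pairing that, unlike Cantor's, is a term of the language. *)
Definition npair (a b : nat) : nat := (a + b) * (a + b) + a.
Definition npair1 (c : nat) : nat := c - Nat.sqrt c * Nat.sqrt c.
Definition npair2 (c : nat) : nat := Nat.sqrt c - npair1 c.

Lemma sqrt_npair a b : Nat.sqrt (npair a b) = a + b.
Proof. by apply: Nat.sqrt_unique; rewrite /npair; nia. Qed.

Lemma npairK1 a b : npair1 (npair a b) = a.
Proof. by rewrite /npair1 sqrt_npair /npair; lia. Qed.

Lemma npairK2 a b : npair2 (npair a b) = b.
Proof. by rewrite /npair2 sqrt_npair npairK1; lia. Qed.

Definition node (k a b : nat) : nat := npair k (npair a b).

Lemma ltn_node1 k a b : 0 < k -> a < node k a b.
Proof. rewrite /node /npair; nia. Qed.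

Lemma ltn_node2 k a b : 0 < k -> b < node k a b.
Proof. rewrite /node /npair; nia. Qed.

Local Notation update e x n := [eta e with x |-> n].

(* Truth is being nonzero, so that conjunction is product and disjunction is sum; tag 8 is
   universal quantification over the variable [a]. *)
Definition ceval_body (F : nat -> nat -> nat) (c : nat)
    (rec : forall c' : nat, (c' < c)%coq_nat -> (nat -> nat) -> nat)
    (e : nat -> nat) : nat :=
  let k := npair1 c in let a := npair1 (npair2 c) in let b := npair2 (npair2 c) in
  let sub c' := if lt_dec c' c is left h then rec c' h else fun=> 0 in
  if c == node k a b then
    match k with
    | 1 => e b
    | 2 => b
    | 3 => sub a e + sub b e
    | 4 => sub a e * sub b e
    | 5 => F a (sub b e)
    | 6 => sub a e == sub b e
    | 7 => sub a e < sub b e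
    | 8 => `[< forall n, 0 < sub b (update e a n) >]
    | _ => 0
    end
  else 0.

Definition ceval F : nat -> (nat -> nat) -> nat :=
  Fix lt_wf (fun _ => (nat -> nat) -> nat) (ceval_body F).

Lemma ceval_node F k a b e : 0 < k ->
  ceval F (node k a b) e =
    match k with
    | 1 => e b
    | 2 => b
    | 3 => ceval F a e + ceval F b e
    | 4 => ceval F a e * ceval F b e
    | 5 => F a (ceval F b e)
    | 6 => ceval F a e == ceval F b e
    | 7 => ceval F a e < ceval F b e
    | 8 => `[< forall n, 0 < ceval F b (update e a n) >]
    | _ => 0
    end.
Proof.
move=> k0; rewrite /ceval Fix_eq; last first.
  move=> c f g fg; congr ceval_body.
  by apply: functional_extensionality_dep => c'; apply: functional_extensionality_dep.
rewrite {1}/ceval_body /node npairK1 npairK2 npairK1 npairK2 eqxx -/(node k a b).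
case: lt_dec => [_|]; last by move/ltP: (ltn_node1 a b k0).
case: lt_dec => [_|]; last by move/ltP: (ltn_node2 a b k0).
by [].
Qed.

(** [npair] is not onto, so some numbers are no node at all. Together with [ceval_node] this fixes
    [ceval] on every number. *)
Lemma ceval_junk F c e : (forall k a b, 0 < k < 9 -> c <> node k a b) -> ceval F c e = 0.
Proof.
move=> junk; rewrite /ceval Fix_eq; last first.
  move=> x f g fg; congr ceval_body.
  by apply: functional_extensionality_dep => c'; apply: functional_extensionality_dep.
rewrite {1}/ceval_body; case: eqP => // Ec.
case: (posnP (npair1 c)) => [->//|k0].
case: (ltnP (npair1 c) 9) => k9; first by
  case: (junk (npair1 c) (npair1 (npair2 c)) (npair2 (npair2 c))); rewrite ?k0.
by move: (npair1 c) k9; do 9!case=> //.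
Qed.

Fixpoint tcode (t : term) : nat :=
  match t with
  | TVar x => node 1 0 x
  | TZero => node 2 0 0
  | TSucc t => node 3 (tcode t) (node 2 0 1)
  | TAdd t u => node 3 (tcode t) (tcode u)
  | TMul t u => node 4 (tcode t) (tcode u)
  | TApp f t => node 5 f (tcode t)
  end.

Definition ncode (c : nat) : nat := node 6 c (node 2 0 0).

Fixpoint fcode (p : formula) : nat :=
  match p with
  | FEq t u => node 6 (tcode t) (tcode u)
  | FLt t u => node 7 (tcode t) (tcode u)
  | FNot p => ncode (fcode p)
  | FAnd p q => node 4 (fcode p) (fcode q)
  | FOr p q => node 3 (fcode p) (fcode q)
  | FAll x p => node 8 x (fcode p)
  | FEx x p => ncode (node 8 x (ncode (fcode p)))
  end.

Lemma ceval_tcode F e t : ceval F (tcode t) e = teval F e t.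
Proof.
elim: t => /= [x||t IH|t IHt u IHu|t IHt u IHu|f t IH]; rewrite !ceval_node //.
- by rewrite IH addn1.
- by rewrite IHt IHu.
- by rewrite IHt IHu.
- by rewrite IH.
Qed.

Lemma ceval_ncode F c e : (0 < ceval F (ncode c) e) = ~~ (0 < ceval F c e).
Proof. by rewrite !ceval_node //; case: (ceval F c e). Qed.

Lemma ceval_fcode F p e : 0 < ceval F (fcode p) e <-> holds F e p.
Proof.
elim: p e => [t u|t u|p IH|p IHp q IHq|p IHp q IHq|x p IH|x p IH] e /=.
- rewrite ceval_node // !ceval_tcode lt0b; split=> /eqP //.
- by rewrite ceval_node // !ceval_tcode lt0b.
- by rewrite ceval_ncode -IH; split=> /negP.
- by rewrite ceval_node // muln_gt0 -IHp -IHq; split=> /andP.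
- by rewrite ceval_node // addn_gt0 -IHp -IHq; split=> /orP.
- rewrite ceval_node // lt0b; split=> [/asboolP H n|H]; first by apply/IH.
  by apply/asboolP => n; apply/IH.
- rewrite ceval_ncode ceval_node // lt0b; split=> [/asboolPn/existsNP[n H]|[n /IH H]].
    by exists n; apply/IH; move: H; rewrite ceval_ncode => /negP; rewrite negbK.
  by apply/negP => /asboolP/(_ n); rewrite ceval_ncode H.
Qed.

(** * The construction of the oracle *)

Definition in_col (k n : nat) : Prop := exists m, k = npair n m.
Definition in_col_ge (k n : nat) : Prop := exists i, n <= i /\ in_col k i.

Definition extends (n : nat) (t u : seq bool) : Prop :=
  [/\ size t <= size u,
      forall k, k < size t -> nth false u k = nth false t k &
      forall k, size t <= k -> nth false u k -> in_col_ge k n].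

Definition marked (t : seq bool) (n : nat) : Prop :=
  exists k, [/\ nth false t k, in_col k n &
    forall k', k < k' -> nth false t k' -> in_col_ge k' n.+1].

Definition agree (t u : seq bool) : Prop :=
  forall k, k < size t -> k < size u -> nth false t k = nth false u k.

(** The cone of [u] meets W_n: a string [t] agreeing with [u] has a common extension with it. *)
Definition met (U : nat -> seq bool -> seq bool -> Prop) (n : nat) (u : seq bool) :=
  exists t s, [/\ agree t u, n < size s, ~~ nth false s n & U n t s].

Definition forced U (n : nat) (t : seq bool) : Prop :=
  forall u, extends n.+1 t u -> met U n u.

(** [U] occurs only positively and under number quantifiers, and [marked] is arithmetical; hence
    [Gamma U] stays Pi^1_1 when [U] is. *)
Definition Gamma U (ts : seq bool * seq bool) : Prop :=
  forall n, n < size ts.2 ->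
    if nth false ts.2 n then ~ marked ts.1 n /\ forced U n ts.1
    else marked ts.1 n.

Lemma in_col_inj k n n' : in_col k n -> in_col k n' -> n = n'.
Proof. by move=> [m ->] [m' /(congr1 npair1)]; rewrite !npairK1. Qed.

Lemma in_col_ge_false k n n' : in_col_ge k n -> in_col k n' -> n' < n -> False.
Proof. by move=> [i [ni ki]] kn'; rewrite (in_col_inj kn' ki) ltnNge ni. Qed.

Lemma nth_size (t : seq bool) k : nth false t k -> k < size t.
Proof. by case: ltnP => // tk; rewrite nth_default. Qed.

Lemma extends_refl n t : extends n t t.
Proof. by split=> // k tk /nth_size; rewrite ltnNge tk. Qed.

Lemma extends_le n n' t u : n' <= n -> extends n t u -> extends n' t u.
Proof.
move=> le [su eq hi]; split=> // k tk uk.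
by have [i [ni ki]] := hi k tk uk; exists i; split=> //; exact: leq_trans ni.
Qed.

Lemma extends_trans n t u w : extends n t u -> extends n u w -> extends n t w.
Proof.
move=> [stu eqtu hitu] [suw equw hiuw]; split; first exact: leq_trans suw.
  by move=> k kt; rewrite equw ?eqtu //; exact: leq_trans kt stu.
move=> k tk wk; case: (ltnP k (size u)) => ku; last exact: hiuw.
by apply: hitu => //; rewrite -equw.
Qed.

Lemma forced_extends U n t u : extends n.+1 t u -> forced U n t -> forced U n u.
Proof. by move=> tu H w uw; apply: H; exact: extends_trans tu uw. Qed.

Lemma initial_segment_nth t B :
  initial_segment t B <-> forall k, k < size t -> nth false t k = B k.
Proof.
split=> [[l ->] k|H]; first by rewrite size_mkseq => kl; rewrite nth_mkseq.
exists (size t); apply: (@eq_from_nth _ false); rewrite ?size_mkseq // => k kt.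
by rewrite nth_mkseq ?H.
Qed.

Section Construction.

Variable U : nat -> seq bool -> seq bool -> Prop.

Definition next (n : nat) (t t' : seq bool) : Prop :=
  (forced U n t /\ t' = t) \/
  (exists u, [/\ t' = rcons u true, extends n.+1 t u, in_col (size u) n & ~ met U n u]).

Lemma next_exists n t : exists t', next n t t'.
Proof.
have [F|/existsNP[u /not_implyP[tu Nu]]] := pselect (forced U n t).
  by exists t; left.
(* Padding makes the length a position of column [n]. The zeros add no ones, and every string
   agreeing with [v] agrees with [u]. *)
pose v := u ++ nseq (npair n (size u) - size u) false.
have nthv k : nth false v k = nth false u k.
  by rewrite nth_cat nth_nseq; case: ltnP => // uk; rewrite if_same nth_default.
have sv : size v = npair n (size u).
  by rewrite size_cat size_nseq subnKC // /npair; nia.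
have suv : size u <= size v by rewrite size_cat leq_addr.
exists (rcons v true); right; exists v; split=> //.
- case: tu => stu eq hi; split; first exact: leq_trans suv.
    by move=> k kt; rewrite nthv eq.
  by move=> k tk; rewrite nthv; apply: hi.
- by exists (size u).
- apply: contra_not Nu => -[t1 [s [ag sn s0 Us]]]; exists t1, s; split=> // k kt ku.
  by rewrite ag ?nthv //; exact: leq_trans suv.
Qed.

Lemma next_extends n t t' : next n t t' -> extends n t t'.
Proof.
case=> [[_ ->]|[u [-> tu coln _]]]; first exact: extends_refl.
apply: extends_trans (extends_le (leqnSn n) tu) _.
split; first by rewrite size_rcons.
  by move=> k ku; rewrite nth_rcons ku.
move=> k uk; rewrite nth_rcons ltnNge uk /=.
by case: eqP => // -> _; exists n.
Qed.

Fixpoint stage (n : nat) : seq bool :=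
  if n is m.+1 then projT1 (cid (next_exists m (stage m))) else [::].

Lemma stageP n : next n (stage n) (stage n.+1).
Proof. by rewrite /=; case: cid. Qed.

Lemma stage_extends n m : n <= m -> extends n (stage n) (stage m).
Proof.
elim: m => [|m IH]; first by rewrite leqn0 => /eqP ->; exact: extends_refl.
rewrite leq_eqVlt => /orP[/eqP ->|]; first exact: extends_refl.
rewrite ltnS => nm; apply: extends_trans (IH nm) _.
exact: extends_le nm (next_extends (stageP m)).
Qed.

(** The stages may stop growing; positions that none of them reaches get 0. *)
Definition oracle (k : nat) : bool := `[< exists n, nth false (stage n) k >].

Definition target (n : nat) : bool := `[< forced U n (stage n) >].

Lemma oracle_stage n k : k < size (stage n) -> oracle k = nth false (stage n) k.
Proof.
move=> kn; apply/asboolP/idP => [[m mk]|]; last by exists n.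
have [nm|/ltnW mn] := leqP n m; first by have [_ <-] := stage_extends nm.
by have [_ -> //] := stage_extends mn; exact: nth_size.
Qed.

Lemma oracle_extends n l :
  size (stage n) <= l -> extends n (stage n) (mkseq oracle l).
Proof.
move=> nl; split; first by rewrite size_mkseq.
  by move=> k kn; rewrite nth_mkseq ?(oracle_stage kn) //; exact: leq_trans kn nl.
move=> k nk /[dup]/nth_size; rewrite size_mkseq => kl.
rewrite nth_mkseq // => /asboolP[m mk].
have [nm|/ltnW mn] := leqP n m; first by have [_ _] := stage_extends nm; apply.
have [smn _ _] := stage_extends mn.
by have := leq_trans (nth_size mk) smn; rewrite ltnNge nk.
Qed.

(** The last one in a stage is the closing one of an earlier index. It cancels whatever marks in
    column [n] the chosen extensions produced by accident. *)
Lemma stage_last n k : nth false (stage n) k ->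
  exists k' i, [/\ k <= k', nth false (stage n) k', i < n & in_col k' i].
Proof.
elim: n k => [|n IH] k; first by rewrite nth_nil.
case: (stageP n) => [[_ ->] /IH[k' [i [? ? ? ?]]]|[u [-> _ coln _]] uk].
  by exists k', i; split=> //; exact: ltnW.
exists (size u), n; split=> //; last by rewrite nth_rcons ltnn eqxx.
by have := nth_size uk; rewrite size_rcons.
Qed.

(** Beyond stage n only columns above n carry ones, and inside stage n a one of column n is followed
    by a closing one of a smaller column. *)
Lemma unmarked n t : extends n.+1 (stage n) t -> ~ marked t n.
Proof.
move=> [st eq hi] [k [tk kn last]].
have [nk|kn'] := leqP (size (stage n)) k.
  exact: in_col_ge_false (hi k nk tk) kn (ltnSn n).
rewrite eq // in tk; have [k' [i [kk' tk' ni k'i]]] := stage_last tk.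
move: kk'; rewrite leq_eqVlt => /orP[/eqP E|kk'].
  by rewrite -E in k'i; rewrite (in_col_inj kn k'i) ltnn in ni.
have tk'' : nth false t k' by rewrite eq // nth_size.
by apply: in_col_ge_false (last k' kk' tk'') k'i _; exact: leqW.
Qed.

(** If n is forced, stage n+1 equals stage n, which improves the bound on later columns from n to
    n+1. *)
Lemma target_extends n l : target n -> size (stage n) <= l ->
  extends n.+1 (stage n) (mkseq oracle l).
Proof.
move=> /asboolP F nl; have := @oracle_extends n.+1 l.
case: (stageP n) => [[_ ->]|[u [_ nu _]]]; first exact.
by case; exact: F.
Qed.

Lemma marked_oracle n l : size (stage n.+1) <= l -> ~~ target n ->
  marked (mkseq oracle l) n.
Proof.
move=> nl /asboolPn NF; have := oracle_extends nl.
case: (stageP n) => [[/NF//]|[u [-> _ coln _]] [_ eq hi]].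
(* The closing one is the mark, as beyond stage n+1 only columns above n carry ones. *)
exists (size u); split=> //.
  by rewrite eq ?size_rcons // nth_rcons ltnn eqxx.
by move=> k uk; apply: hi; rewrite size_rcons.
Qed.

(* Until t reaches stage n+1, t is a prefix of the string u chosen at that stage, and u
   witnesses that n is not yet forced. *)
Lemma Gamma_size t s : initial_segment t oracle -> Gamma U (t, s) ->
  size (stage (size s)) <= size t.
Proof.
move=> [l ->] H; suff: forall n, n <= size s -> size (stage n) <= size (mkseq oracle l) by exact.
rewrite size_mkseq; elim=> // n IH ns; have {IH} nl := IH (ltnW ns).
rewrite leqNgt; apply/negP => ln.
have := stageP n; case=> [[_ E]|[u [E nu coln Nu]]].
  by rewrite E ltnNge nl in ln.
rewrite E size_rcons ltnS in ln.
have eq k : k < l -> nth false (mkseq oracle l) k = nth false u k.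
  move=> kl; have ku := leq_trans kl ln.
  by rewrite nth_mkseq // (@oracle_stage n.+1) E ?nth_rcons ?ku // size_rcons; exact: ltnW.
have [snu equ hiu] := nu.
have lu : extends n.+1 (mkseq oracle l) u.
  split; rewrite ?size_mkseq //; first by move=> k kl; rewrite eq.
  by move=> k lk; apply: hiu; exact: leq_trans lk.
have nl' : extends n.+1 (stage n) (mkseq oracle l).
  split; rewrite ?size_mkseq //; first by move=> k kn; rewrite eq ?equ //; exact: leq_trans nl.
  move=> k nk /[dup] /nth_size; rewrite size_mkseq => kl; rewrite eq //; exact: hiu.
have Nm := unmarked nl'.
by have := H n ns; case: ifP => // _ [_ /(_ u lu)].
Qed.

(** By [Gamma_size], [t] contains stage n+1 for each bit n of [s], and from there on column n is
    marked exactly when [target n] fails. *)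
Lemma Gamma_oracle t s : initial_segment t oracle -> Gamma U (t, s) -> initial_segment s target.
Proof.
move=> At H; apply/initial_segment_nth => n ns.
have := H n ns; have := Gamma_size At H; case: At => l ->; rewrite size_mkseq => sl.
have nl : size (stage n.+1) <= l.
  by apply: leq_trans _ sl; have [] := stage_extends ns.
have nl' : size (stage n) <= l.
  by apply: leq_trans _ nl; have [] := stage_extends (leqnSn n).
rewrite /=; have [T|NT] := boolP (target n); case: (nth false s n) => //.
  by move=> /(unmarked (target_extends T nl')).
by case=> /(_ (marked_oracle nl NT)).
Qed.

Lemma Gamma_stage n : Gamma U (mkseq oracle (size (stage n)), mkseq target n).
Proof.
move=> j; rewrite size_mkseq => jn /=; rewrite nth_mkseq //.
have jl : size (stage j.+1) <= size (stage n) by have [] := stage_extends jn.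
have jl' : size (stage j) <= size (stage n) by have [] := stage_extends (ltnW jn).
case: ifP => [T|/negbT NT]; last exact: marked_oracle.
have ext := target_extends T jl'; split; first exact: unmarked.
by apply: forced_extends ext _; exact/asboolP.
Qed.

(** [Gamma_oracle] makes all outputs prefixes of [target], and [Gamma_stage] supplies outputs of
    every length. *)
Lemma Gamma_maps : functional_maps (Gamma U) oracle target.
Proof.
have cmp a b : a <= b -> prefix (mkseq target a) (mkseq target b).
  by move=> ab; rewrite -(subnKC ab) /mkseq iotaD map_cat prefix_prefix.
split.
  move=> s s' [t [At /(Gamma_oracle At)[a ->]]] [t' [At' /(Gamma_oracle At')[b ->]]].
  by rewrite /Defs.comparable; case: (leqP a b) => [|/ltnW] /cmp ->; rewrite ?orbT.
move=> n b; split=> [[t [s [At /(Gamma_oracle At)[m ->] E]]]|<-].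
  have nm : n < m by rewrite -(size_mkseq target m) -onthTE E.
  by rewrite -(onth_nth false _ _ _ E) nth_mkseq.
exists (mkseq oracle (size (stage n.+1))), (mkseq target n.+1); split.
- by exists (size (stage n.+1)).
- exact: Gamma_stage.
- by rewrite onthE (nth_map false) ?size_mkseq // nth_mkseq.
Qed.

Lemma target_diagonal n Psi : (forall t s, U n t s <-> Psi (t, s)) ->
  everywhere_consistent Psi -> ~ functional_maps Psi oracle target.
Proof.
move=> UP EC [_ map]; have [T|NT] := boolP (target n).
  have [t [s [[l tl] Pt sn]]] := (map n true).2 T.
  (* This prefix of the oracle is long enough to contain both [t] and stage n. *)
  have := T => /asboolP/(_ (mkseq oracle (maxn l (size (stage n))))).
  have ext := target_extends T (leq_maxr l _).
  move=> /(_ ext)[t' [s' [ag sn' s'0 /UP Pt']]].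
  (* [B] follows [t'] and then the oracle. It still extends [t], because [t'] agrees with an oracle
     prefix containing [t]. *)
  pose B k := if k < size t' then nth false t' k else oracle k.
  have tB : initial_segment t B.
    apply/initial_segment_nth => k; rewrite /B tl size_mkseq => kl.
    have klm : k < maxn l (size (stage n)) by rewrite leq_max kl.
    by rewrite nth_mkseq //; case: ifP => // kt'; rewrite ag ?size_mkseq // nth_mkseq.
  have t'B : initial_segment t' B.
    by apply/initial_segment_nth => k kt'; rewrite /B kt'.
  have := EC B s s' (ex_intro _ t (conj tB Pt)) (ex_intro _ t' (conj t'B Pt')).
  have ns : n < size s by rewrite -onthTE sn.
  have s1 : nth false s n by rewrite (onth_nth false _ _ _ sn).
  by case/orP=> /prefixP[w E]; move: s1 s'0; rewrite E nth_cat ?ns ?sn' => ->.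
(* Now [u] avoids W_n and is a prefix of the oracle, so the [t] that yields output 0 at n agrees
   with [u]. *)
have [t [s [[l tl] Pt sn]]] := (map n false).2 (negbTE NT).
have := stageP n; case=> [[/asboolP]|[u [E _ _]]]; first by rewrite -/(target n) (negbTE NT).
apply; exists t, s; split; first 1 last.
- by rewrite -onthTE sn.
- by rewrite (onth_nth false _ _ _ sn).
- exact/UP.
move=> k; rewrite tl size_mkseq => kl ku.
by rewrite nth_mkseq // (@oracle_stage n.+1) E ?nth_rcons ?ku // size_rcons; exact: ltnW.
Qed.

End Construction.

(** * The functional is Pi^1_1 *)

Lemma string_code_rcons s b : string_code (rcons s b) = (string_code s).*2 + b.
Proof. by rewrite /string_code foldl_rcons. Qed.

Lemma string_code_gt0 s : 0 < string_code s.
Proof. elim/last_ind: s => // s b IH; rewrite string_code_rcons; lia. Qed.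

Lemma string_code_inj : injective string_code.
Proof.
have nil_rcons s b : string_code [::] <> string_code (rcons s b).
  have := string_code_gt0 s; rewrite string_code_rcons.
  by case: b => /=; rewrite /(string_code [::]) /=; lia.
elim/last_ind=> [|s b IH] s'; case/lastP: s' => //.
- by move=> s' b' /nil_rcons.
- by move=> /esym/nil_rcons.
move=> s' b'; rewrite !string_code_rcons => E.
suff [/IH -> ->] : string_code s = string_code s' /\ b = b' by [].
by move: E; case: b; case: b' => /=; lia.
Qed.

Lemma string_code_surj x : 0 < x -> exists s, string_code s = x.
Proof.
have [m] := ubnP x; elim: m x => // m IH x xm x0.
have [x1|x1] := ltnP 1 x; last by exists [::]; rewrite /string_code /=; lia.
have [|//|s sx] := IH x./2; [lia | lia |].
by exists (rcons s (odd x)); rewrite string_code_rcons sx; lia.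
Qed.

(* [0] codes no string; decoding it to the empty string makes decoding total. *)
Definition string_decode (x : nat) : seq bool :=
  if pselect (exists s, string_code s = x) is left h then projT1 (cid h) else [::].

Lemma string_codeK : cancel string_code string_decode.
Proof.
move=> s; rewrite /string_decode; case: pselect => [h|[]]; last by exists s.
by case: cid => s' E /=; exact: string_code_inj.
Qed.

Lemma string_decodeK x : 0 < x -> string_code (string_decode x) = x.
Proof. by move=> /string_code_surj[s <-]; rewrite string_codeK. Qed.

Lemma string_decode0 : string_decode 0 = [::].
Proof.
rewrite /string_decode; case: pselect => // -[s E].
by have := string_code_gt0 s; rewrite E.
Qed.

Lemma string_decode1 : string_decode 1 = [::].
Proof. exact: (string_codeK [::]). Qed.

Lemma string_decode_double x (b : bool) : 0 < x ->
  string_decode (x + x + b) = rcons (string_decode x) b.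
Proof.
by move=> x0; rewrite addnn -{1}(string_decodeK x0) -string_code_rcons string_codeK.
Qed.

(** Induction on appended bits, the recursion used by [fstrings]. Both 0 and 1 are base cases, as
    both decode to the empty string. *)
Lemma string_decode_ind (P : nat -> Prop) :
  P 0 -> P 1 -> (forall x (b : bool), 0 < x -> P x -> P (x + x + b)) -> forall x, P x.
Proof.
move=> P0 P1 PS x; have [m] := ubnP x; elim: m x => // -[|m] IH x xm; first by case: x xm.
have [x1|] := ltnP 1 x; last by case: x xm => [|[]].
have -> : x = x./2 + x./2 + odd x by rewrite addnn; lia.
by apply: PS; [lia | apply: IH; lia].
Qed.

(** * Axioms for evaluation, environments and strings *)

Definition tnum (k : nat) : term := iter k TSucc TZero.
Definition tpair (t u : term) : term := TAdd (TMul (TAdd t u) (TAdd t u)) t.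
Definition tnode (k : nat) (t u : term) : term := tpair (tnum k) (tpair t u).
Definition tfun (i f x : term) : term := TApp 0 (tpair i (tpair f x)).
Definition tcval (i c e : term) : term := TApp 1 (tpair i (tpair c e)).
Definition tlookup (e x : term) : term := TApp 2 (tpair e x).
Definition tupdate (e x n : term) : term := TApp 3 (tpair e (tpair x n)).
Definition tlen (x : term) : term := TApp 4 x.
Definition tbit (x k : term) : term := TApp 5 (tpair x k).

(* The function variable 0 holds a family of interpretations, indexed by [i]; an environment
   is coded by a number [e] that is only accessed by lookup and update. *)
Definition Gfun (G : nat -> nat -> nat) i f x := G 0 (npair i (npair f x)).
Definition Gval (G : nat -> nat -> nat) i c e := G 1 (npair i (npair c e)).
Definition Glookup (G : nat -> nat -> nat) e x := G 2 (npair e x).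
Definition Gupdate (G : nat -> nat -> nat) e x n := G 3 (npair e (npair x n)).
Definition Glen (G : nat -> nat -> nat) x := G 4 x.
Definition Gbit (G : nat -> nat -> nat) x k := G 5 (npair x k).

Definition fchar (t : term) (p : formula) : formula :=
  FOr (FAnd (FEq t (tnum 1)) p) (FAnd (FEq t (tnum 0)) (FNot p)).

(** The clauses of [ceval_node] as axioms on function variable 1, so that the truth of a coded
    formula is read off from one function value. *)
Definition fvals : formula :=
  let i := TVar 0 in let e := TVar 1 in let a := TVar 2 in let b := TVar 3 in
  let va := tcval i a e in let vb := tcval i b e in
  let v k := tcval i (tnode k a b) e in
  FAll 0 (FAll 1 (FAll 2 (FAll 3 (
    FAnd (FEq (v 1) (tlookup e b)) (
    FAnd (FEq (v 2) b) (
    FAnd (FEq (v 3) (TAdd va vb)) (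
    FAnd (FEq (v 4) (TMul va vb)) (
    FAnd (FEq (v 5) (tfun i a vb)) (
    FAnd (fchar (v 6) (FEq va vb)) (
    FAnd (fchar (v 7) (FLt va vb))
         (fchar (v 8) (FAll 4 (FLt TZero (tcval i b (tupdate e a (TVar 4)))))))))))))))).

Definition fjunk : formula :=
  let i := TVar 0 in let e := TVar 1 in let c := TVar 2 in
  let k := TVar 3 in let a := TVar 4 in let b := TVar 5 in
  FAll 0 (FAll 1 (FAll 2 (
    FOr (FEq (tcval i c e) TZero)
        (FEx 3 (FEx 4 (FEx 5 (
          FAnd (FLt TZero k) (FAnd (FLt k (tnum 9)) (FEq c (tpair k (tpair a b))))))))))).

Definition flookup : formula :=
  let e := TVar 0 in let x := TVar 1 in let n := TVar 2 in let y := TVar 3 in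
  FAnd (FAll 1 (FEq (tlookup TZero x) TZero))
  (FAll 0 (FAll 1 (FAll 2 (FAll 3 (
    FOr (FAnd (FEq y x) (FEq (tlookup (tupdate e x n) y) n))
        (FAnd (FNot (FEq y x)) (FEq (tlookup (tupdate e x n) y) (tlookup e y)))))))).

Definition fstrings : formula :=
  let x := TVar 0 in let k := TVar 1 in
  let next b :=
    let y := TAdd (TAdd x x) (tnum b) in
    FAnd (FEq (tlen y) (TSucc (tlen x)))
         (FOr (FAnd (FEq k (tlen x)) (FEq (tbit y k) (tnum b)))
              (FAnd (FNot (FEq k (tlen x))) (FEq (tbit y k) (tbit x k)))) in
  FAnd (FAll 1 (FAnd (FAnd (FEq (tlen TZero) TZero) (FEq (tbit TZero k) TZero))
                     (FAnd (FEq (tlen (tnum 1)) TZero) (FEq (tbit (tnum 1) k) TZero))))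
       (FAll 0 (FAll 1 (FOr (FEq x TZero) (FAnd (next 0) (next 1))))).

Definition faxioms : formula := FAnd (FAnd fvals fjunk) (FAnd flookup fstrings).

Definition char_spec (v : nat) (P : Prop) : Prop := (v = 1 /\ P) \/ (v = 0 /\ ~ P).

Lemma char_specP v P : char_spec v P <-> v = `[< P >].
Proof.
split=> [[[-> H]|[-> H]]|->]; first by rewrite (asboolT H).
  by rewrite (asboolF H).
by case: asboolP => H; [left | right].
Qed.

Definition vals_spec G : Prop := forall i e a b,
  let va := Gval G i a e in let vb := Gval G i b e in
  let v k := Gval G i (node k a b) e in
  v 1 = Glookup G e b /\ v 2 = b /\ v 3 = va + vb /\ v 4 = va * vb /\
  v 5 = Gfun G i a vb /\ char_spec (v 6) (va = vb) /\ char_spec (v 7) (va < vb) /\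
  char_spec (v 8) (forall n, 0 < Gval G i b (Gupdate G e a n)).

(* Needed for [Gval] to be determined at every index n, also at those coding no formula. *)
Definition junk_spec G : Prop := forall i e c,
  Gval G i c e = 0 \/ exists k a b, 0 < k /\ k < 9 /\ c = node k a b.

Definition lookup_spec G : Prop :=
  (forall x, Glookup G 0 x = 0) /\
  forall e x n y,
    (y = x /\ Glookup G (Gupdate G e x n) y = n) \/
    (y <> x /\ Glookup G (Gupdate G e x n) y = Glookup G e y).

Definition strings_spec G : Prop :=
  let next x k b :=
    Glen G (x + x + b) = (Glen G x).+1 /\
    ((k = Glen G x /\ Gbit G (x + x + b) k = b) \/
     (k <> Glen G x /\ Gbit G (x + x + b) k = Gbit G x k)) in
  (forall k, (Glen G 0 = 0 /\ Gbit G 0 k = 0) /\ (Glen G 1 = 0 /\ Gbit G 1 k = 0)) /\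
  forall x k, x = 0 \/ (next x k 0 /\ next x k 1).

(** The [_spec] predicates follow the shape of the formulas so closely that both sides are
    convertible; likewise for [holds_Gamma]. *)
Lemma holds_axioms G e : holds G e faxioms <->
  (vals_spec G /\ junk_spec G) /\ (lookup_spec G /\ strings_spec G).
Proof. by []. Qed.

Definition standard (G : nat -> nat -> nat) : Prop :=
  [/\ forall i c e, Gval G i c e = ceval (Gfun G i) c (Glookup G e),
      forall x, Glookup G 0 x = 0,
      forall e x n, Glookup G (Gupdate G e x n) = update (Glookup G e) x n,
      forall x, Glen G x = size (string_decode x) &
      forall x k, Gbit G x k = nth false (string_decode x) k].

(** Induction on codes determines [Gval] from [Gfun] and [Glookup]; induction on appended bits
    determines lengths and bits. *)
Lemma standardP G e : holds G e faxioms <-> standard G.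
Proof.
rewrite holds_axioms; split=> [[[V J] [[L0 L] [S0 S]]]|[V L0 LU Ln Bt]].
  have LU e' x n : Glookup G (Gupdate G e' x n) = update (Glookup G e') x n.
    apply/funext => y /=.
    by case: (L e' x n y) => -[]; [move=> -> ->; rewrite eqxx | move/eqP/negbTE => -> ->].
  have Ln x : Glen G x = size (string_decode x).
    elim/string_decode_ind: x => [||x b x0 IH].
    + by rewrite string_decode0; have [[]] := S0 0.
    + by rewrite string_decode1; have [_ []] := S0 0.
    + rewrite string_decode_double // size_rcons -IH.
      by case: (S x 0) => [E|[[E0 _] [E1 _]]]; [rewrite E in x0 | case: b].
  split=> //.
  - move=> i c; have [m] := ubnP c; elim: m c => // m IH c cm e'.
    have [[k [a [b [/andP[k0 k9] E]]]]|N] := pselect (exists k a b, 0 < k < 9 /\ c = node k a b).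
      have IHa e1 : Gval G i a e1 = ceval (Gfun G i) a (Glookup G e1).
        by apply: IH; rewrite (leq_trans (ltn_node1 a b k0)) // -E -ltnS.
      have IHb e1 : Gval G i b e1 = ceval (Gfun G i) b (Glookup G e1).
        by apply: IH; rewrite (leq_trans (ltn_node2 a b k0)) // -E -ltnS.
      rewrite {}E ceval_node // in cm *; have := V i e' a b => /=.
      rewrite !IHa !IHb.
      case=> v1 [v2 [v3 [v4 [v5 [/char_specP v6 [/char_specP v7 /char_specP v8]]]]]].
      (* Tags 1 to 5 are the equations [v1] to [v5]; tags 6, 7 and 8 remain. *)
      case: k k0 k9 {cm} => [//|[|[|[|[|[|[|[|[|//]]]]]]]]] _ _ //.
        by rewrite v6; congr nat_of_bool; apply/asboolP/eqP.
        by rewrite v7 asboolb.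
      by rewrite v8; congr (nat_of_bool (asbool _)); apply/propext; split=> H n;
        have := H n; rewrite IHb LU.
    rewrite ceval_junk; last by move=> k a b k9 E; apply: N; exists k, a, b.
    case: (J i e' c) => [//|[k [a [b [k0 [k9 E]]]]]].
    by case: N; exists k, a, b; rewrite k0.
  - move=> x k; elim/string_decode_ind: x => [||x b x0 IH].
    + by rewrite string_decode0 nth_nil; have [[]] := S0 k.
    + by rewrite string_decode1 nth_nil; have [_ []] := S0 k.
    + rewrite string_decode_double // nth_rcons -Ln.
      have [E|[[_ N0] [_ N1]]] := S x k; first by rewrite E in x0.
      have : (k = Glen G x /\ Gbit G (x + x + b) k = b) \/
             (k <> Glen G x /\ Gbit G (x + x + b) k = Gbit G x k) by case: b.
      case=> -[]; first by move=> -> ->; rewrite ltnn eqxx.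
      move/eqP => ne ->; rewrite IH (negbTE ne); case: ltnP => //.
      by rewrite Ln => /(nth_default false) ->.
split; split.
- move=> i e' a b; rewrite /= !V !ceval_node //; do 5!split=> //; split; [|split]; apply/char_specP.
  + by congr nat_of_bool; apply/eqP/asboolP.
  + by rewrite asboolb.
  + congr (nat_of_bool (asbool _)); apply/propext; split=> H n; have := H n; rewrite V LU //.
- move=> i e' c; rewrite V.
  have [[k [a [b [/andP[k0 k9] E]]]]|N] := pselect (exists k a b, 0 < k < 9 /\ c = node k a b).
    by right; exists k, a, b.
  by left; rewrite ceval_junk // => k a b k9 E; apply: N; exists k, a, b.
- split=> // e' x n y; rewrite LU /=; case: eqP => [->|]; first by left.
  by right.
- split=> [k|x k]; first by rewrite !Ln !Bt string_decode0 string_decode1 nth_nil.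
  case: (posnP x) => [->|x0]; [by left | right].
  have next (b : bool) : Glen G (x + x + b) = (Glen G x).+1 /\
      ((k = Glen G x /\ Gbit G (x + x + b) k = b) \/
       (k <> Glen G x /\ Gbit G (x + x + b) k = Gbit G x k)).
    rewrite !Ln !Bt string_decode_double // size_rcons nth_rcons; split=> //.
    case: ltngtP => [kx|kx|->]; [right|right|by left].
      by split=> // E; rewrite E ltnn in kx.
    by rewrite nth_default ?(ltnW kx) //; split=> // E; rewrite E ltnn in kx.
  by split; [exact: (next false) | exact: (next true)].
Qed.

(** Expands an arbitrary family [H] to a standard structure. Environments are coded finite sequences
    read as 0 past their end; 0 codes the empty one. *)
Definition model (H : nat -> nat -> nat -> nat) (f x : nat) : nat :=
  let a := npair1 x in let b := npair2 x in
  match f with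
  | 0 => H a (npair1 b) (npair2 b)
  | 1 => ceval (H a) (npair1 b) (nth 0 (CodeSeq.decode (npair2 b)))
  | 2 => nth 0 (CodeSeq.decode a) b
  | 3 => CodeSeq.code (set_nth 0 (CodeSeq.decode a) (npair1 b) (npair2 b))
  | 4 => size (string_decode x)
  | 5 => nth false (string_decode a) b
  | _ => 0
  end.

Lemma Gfun_model H : Gfun (model H) = H.
Proof.
apply/funext => i; apply/funext => f; apply/funext => x.
by rewrite /Gfun /= !npairK1 !npairK2 !npairK1.
Qed.

Lemma standard_model H : standard (model H).
Proof.
split=> [i c e|x|e x n|//|x k]; rewrite ?Gfun_model.
- rewrite /Gval /= !npairK1 !npairK2 !npairK1; congr ceval.
  by apply/funext => x; rewrite /Glookup /= npairK1 npairK2.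
- by rewrite /Glookup /= npairK1 npairK2 nth_nil.
- apply/funext => y; rewrite /Glookup /Gupdate /= !npairK1 !npairK2 !npairK1 CodeSeq.codeK.
  by rewrite nth_set_nth.
- by rewrite /Gbit /= npairK1 npairK2.
Qed.

(** * A formula defining the functional *)

Definition fcol (k n : nat) : formula := FEx 9 (FEq (TVar k) (tpair (TVar n) (TVar 9))).

Definition fcol_ge (n : term) : formula :=
  FEx 8 (FAnd (FLt n (TSucc (TVar 8))) (fcol 6 8)).

(** Variables 0 and 1 hold the input and output codes, 2 the index n. A strict inequality against a
    successor expresses [<=], and disjunctions serve as implications. *)
Definition fmarked : formula :=
  let t := TVar 0 in let k := TVar 7 in let k' := TVar 6 in
  FEx 7 (FAnd (FEq (tbit t k) (tnum 1)) (FAnd (fcol 7 2)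
    (FAll 6 (FOr (FLt k' (TSucc k))
      (FOr (FEq (tbit t k') TZero) (fcol_ge (TSucc (TVar 2)))))))).

Definition fextends : formula :=
  let t := TVar 0 in let u := TVar 3 in let k := TVar 6 in
  FAnd (FLt (tlen t) (TSucc (tlen u)))
  (FAnd (FAll 6 (FOr (FLt (tlen t) (TSucc k)) (FEq (tbit u k) (tbit t k))))
        (FAll 6 (FOr (FLt k (tlen t))
          (FOr (FEq (tbit u k) TZero) (fcol_ge (TSucc (TVar 2))))))).

(** The index [tpair n (tpair t s)] gives each instance its own interpretation. [t] and [s] must be
    positive because the evaluator receives them as numbers, whereas [u] is read only through its
    length and bits. *)
Definition fmet : formula :=
  let n := TVar 2 in let u := TVar 3 in let t := TVar 4 in let s := TVar 5 in
  let k := TVar 6 in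
  FEx 4 (FEx 5 (FAnd (FAnd (FLt TZero t) (FLt TZero s)) (FAnd
    (FAll 6 (FOr (FLt (tlen t) (TSucc k))
      (FOr (FLt (tlen u) (TSucc k)) (FEq (tbit t k) (tbit u k))))) (FAnd
    (FAnd (FLt n (tlen s)) (FEq (tbit s n) TZero))
    (FLt TZero (tcval (tpair n (tpair t s)) n
      (tupdate (tupdate TZero TZero t) (tnum 1) s))))))).

Definition fGamma : formula :=
  let s := TVar 1 in let n := TVar 2 in
  FAll 2 (FOr (FLt (tlen s) (TSucc n))
    (FOr (FAnd (FEq (tbit s n) TZero) fmarked)
         (FAnd (FEq (tbit s n) (tnum 1)) (FAnd (FNot fmarked)
           (FAll 3 (FOr (FNot fextends) fmet)))))).

Section Semantics.

Variable G : nat -> nat -> nat.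

Definition marked_spec x n : Prop := exists k, Gbit G x k = 1 /\ in_col k n /\
  forall k', k' <= k \/ Gbit G x k' = 0 \/ in_col_ge k' n.+1.

Definition extends_spec n x u : Prop :=
  Glen G x <= Glen G u /\
  (forall k, Glen G x <= k \/ Gbit G u k = Gbit G x k) /\
  (forall k, k < Glen G x \/ Gbit G u k = 0 \/ in_col_ge k n.+1).

Definition met_spec n u : Prop := exists t s,
  (0 < t /\ 0 < s) /\
  (forall k, Glen G t <= k \/ Glen G u <= k \/ Gbit G t k = Gbit G u k) /\
  (n < Glen G s /\ Gbit G s n = 0) /\
  0 < Gval G (npair n (npair t s)) n (Gupdate G (Gupdate G 0 0 t) 1 s).

Definition Gamma_spec x y : Prop := forall n, Glen G y <= n \/
  (Gbit G y n = 0 /\ marked_spec x n) \/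
  (Gbit G y n = 1 /\ ~ marked_spec x n /\
   forall u, ~ extends_spec n x u \/ met_spec n u).

Lemma holds_Gamma x y : holds G (nth 0 [:: x; y]) fGamma <-> Gamma_spec x y.
Proof. by []. Qed.

Hypothesis stdG : standard G.

Definition coded n (t s : seq bool) : Prop :=
  let x := string_code t in let y := string_code s in
  0 < ceval (Gfun G (npair n (npair x y))) n (nth 0 [:: x; y]).

Let GlenE x : Glen G x = size (string_decode x). Proof. by case: stdG. Qed.
Let GbitE x k : Gbit G x k = nth false (string_decode x) k. Proof. by case: stdG. Qed.

Lemma marked_specP x n : marked_spec x n <-> marked (string_decode x) n.
Proof.
split=> -[k]; rewrite ?GbitE.
  move=> [xk [kn H]]; exists k; split=> //; first by case: nth xk.
  move=> k' kk' xk'; case: (H k') => [|[]] //; first by rewrite leqNgt kk'.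
  by rewrite GbitE xk'.
move=> [xk kn H]; exists k; rewrite GbitE xk; do !split=> //.
move=> k'; rewrite GbitE; case: leqP => [|kk']; [by left | right].
by case E: nth; [right; exact: H | left].
Qed.

Lemma extends_specP n x u :
  extends_spec n x u <-> extends n.+1 (string_decode x) (string_decode u).
Proof.
rewrite /extends_spec !GlenE; split.
  move=> [xu [eq hi]]; split=> // k kx.
    by case: (eq k) => [|/eqP]; [rewrite leqNgt kx | rewrite !GbitE; do 2!case: nth].
  by move=> uk; case: (hi k) => [|[]] //; [rewrite ltnNge kx | rewrite GbitE uk].
move=> [xu eq hi]; split=> //; split=> k.
  by case: leqP => kx; [left | right; rewrite !GbitE eq].
case: ltnP => kx; [by left | right]; rewrite GbitE.
by case E: nth; [right; exact: hi | left].
Qed.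

Lemma met_specP n u : met_spec n u <-> met coded n (string_decode u).
Proof.
case: stdG => [GvalE L0 LU _ _].
have envE t s : Glookup G (Gupdate G (Gupdate G 0 0 t) 1 s) = nth 0 [:: t; s].
  by rewrite !LU; apply/funext => -[|[|x]] //=; rewrite L0 nth_nil.
split.
  move=> [t [s [[t0 s0] [ag [[ns sn]]]]]]; rewrite GvalE envE => V.
  exists (string_decode t), (string_decode s); rewrite /coded !string_decodeK //; split=> //.
  - move=> k kt ku; case: (ag k) => [|[|]]; rewrite ?GlenE ?GbitE.
    + by rewrite leqNgt kt.
    + by rewrite leqNgt ku.
    + by do 2!case: nth.
  - by rewrite -GlenE.
  - by move: sn; rewrite GbitE; case: nth.
move=> [t [s [ag ns sn V]]]; exists (string_code t), (string_code s).
rewrite GvalE envE !GlenE GbitE !string_codeK (negbTE sn) !string_code_gt0; do !split=> //.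
move=> k; rewrite !GbitE !string_codeK; case: leqP => kt; [by left | right].
by case: leqP => ku; [left | right; rewrite ag].
Qed.

Lemma Gamma_specP x y : Gamma_spec x y <-> Gamma coded (string_decode x, string_decode y).
Proof.
split=> H n /=.
  move=> ny; case: (H n) => [|[[yn /marked_specP m]|[yn [/marked_specP m F]]]].
  - by rewrite GlenE leqNgt ny.
  - by move: yn; rewrite GbitE; case: nth.
  - move: yn; rewrite GbitE; case: nth => // _; split=> // u.
    by case: (F (string_code u)); rewrite ?extends_specP ?met_specP !string_codeK.
rewrite GlenE GbitE marked_specP; case: leqP => ny; [by left | right].
have := H n ny; rewrite /=; case: nth => [[m F]|m]; [right | by left].
split=> //; split=> // u; rewrite extends_specP met_specP.
by have [/F|] := pselect (extends n.+1 (string_decode x) (string_decode u)); [right | left].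
Qed.

End Semantics.

(** * A universal Pi^1_1 relation *)

Definition universal n t s : Prop :=
  forall F, 0 < ceval F n (nth 0 [:: string_code t; string_code s]).

(* A single function G 0 carries one counterexample F for every triple (n, t, s); this moves
   the function quantifier of universal in front of the quantifiers of Gamma. *)
Lemma Gamma_universal t s :
  Gamma universal (t, s) <->
  forall G, standard G -> Gamma (coded G) (t, s).
Proof.
have mono (U U' : nat -> seq bool -> seq bool -> Prop) :
    (forall n t s, U n t s -> U' n t s) -> Gamma U (t, s) -> Gamma U' (t, s).
  move=> UU' H n ns; have := H n ns; case: ifP => // _ [m F]; split=> // u /F.
  by move=> [t' [s' [ag ns' sn /UU' V]]]; exists t', s'.
split=> [H G _|H]; first by apply: mono H => n t' s'; exact.
have /choice[H0 H0P] : forall i : nat, exists F : nat -> nat -> nat,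
    forall n x y, i = npair n (npair x y) -> 0 < ceval F n (nth 0 [:: x; y]) ->
    forall F', 0 < ceval F' n (nth 0 [:: x; y]).
  move=> i.
  have [V|/existsNP[F NF]] := pselect (forall F,
    0 < ceval F (npair1 i) (nth 0 [:: npair1 (npair2 i); npair2 (npair2 i)])).
    (* Where no counterexample exists, any interpretation serves. *)
    by exists (fun=> id) => n x y E _; move: V; rewrite E !npairK1 !npairK2 !npairK1.
  by exists F => n x y E; move: NF; rewrite E !npairK1 !npairK2 !npairK1.
apply: mono (H _ (standard_model H0)) => n t' s'.
rewrite /coded Gfun_model => V; exact: H0P V.
Qed.

(** The formula says that the axioms imply [fGamma], so structures violating the axioms satisfy it
    vacuously and only standard ones count. *)
Lemma Gamma_universal_Pi11 : Pi11 (Gamma universal).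
Proof.
exists (FOr (FNot faxioms) fGamma) => t s; rewrite Gamma_universal.
split=> [H G|H G stdG].
  have [stdG|] := pselect (holds G (nth 0 [:: string_code t; string_code s]) faxioms); last by left.
  right; apply/holds_Gamma/Gamma_specP; first exact/standardP/stdG.
  by rewrite !string_codeK; apply: H; exact/standardP/stdG.
case: (H G) => [[]|/holds_Gamma/(Gamma_specP stdG)]; first exact/standardP.
by rewrite !string_codeK.
Qed.

Theorem theorem4p1 :
  exists A X : nat -> bool,
    higher_computable X A /\
    ~ (exists Phi : seq bool * seq bool -> Prop,
         [/\ higher_Turing_functional Phi,
             everywhere_consistent Phi &
             functional_maps Phi A X]).
Proof.
exists (oracle universal), (target universal); split.
  by exists (Gamma universal); split; [exact: Gamma_universal_Pi11 | exact: Gamma_maps].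
(* The index at which [Psi] is defeated is the code of its defining formula. *)
move=> [Psi [[p Psip] EC]]; apply: (@target_diagonal universal (fcode p)) EC => t s.
by rewrite Psip; split=> H F; apply/ceval_fcode.
Qed.
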